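(* Let $G$ be a finite simple Hamiltonian graph (i.e. $G$ contains a cycle through all of its vertices). Then $G$ admits a strongly connected rigid orientation if and only if $G$ is not a cycle. Moreover, if $G$ is not a cycle, then for every Hamiltonian cycle $C$ of $G$ there exists a strongly connected rigid orientation of $G$ in which $C$ is the unique directed Hamiltonian cycle (that is, $C$ is oriented as a directed cycle and no other directed cycle passes through all vertices).
   Context: An orientation of a graph $G$ is a digraph obtained from $G$ by replacing each edge $xy$ with exactly one of the arcs $\overrightarrow{xy}$, $\overrightarrow{yx}$. An automorphism of a digraph is a vertex permutation preserving arcs together with their directions. An orientation is rigid if its only automorphism is the identity. *)

(* Defs.v *)
From mathcomp Require Import all_boot all_fingroup.

Set Implicit Arguments.
Unset Strict Implicit.
Unset Printing Implicit Defensive.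

(* A finite simple graph is a symmetric irreflexive relation [e] on a finType,
   a finite digraph is an arbitrary relation [d] on a finType. *)

Section Definitions.
Variable T : finType.
Implicit Types (e d : rel T) (c : seq T).

(* A cycle of a simple graph is listed in one of its two traversal directions,
   from an arbitrary starting vertex; the list does not repeat that vertex. The
   bound on the size excludes the closed walks x, y, x. *)
Definition hamiltonian_cycle e c : Prop :=
  [/\ 2 < size c, ucycle e c & forall x, x \in c].

Definition hamiltonian e : Prop := exists c, hamiltonian_cycle e c.

Definition cycle_graph e : Prop :=
  exists c, [/\ 2 < size c, uniq c, forall x, x \in c &
    forall x y, e x y = (y == next c x) || (x == next c y)].

(* The inclusion of [d] in [e] is needed: the exclusive or alone would leave
   the diagonal and the non-edges unconstrained. *)
Definition orientation e d : Prop :=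
  subrel d e /\ forall x y, e x y -> d x y (+) d y x.

Definition strongly_connected d : Prop := forall x y, connect d x y.

Definition automorphism d (s : {perm T}) : Prop :=
  forall x y, d (s x) (s y) = d x y.

Definition rigid d : Prop := forall s, automorphism d s -> s = 1%g.

Definition directed_hamiltonian_cycle d c : Prop :=
  [/\ 0 < size c, ucycle d c & forall x, x \in c].

(* Two duplicate-free lists describe the same directed cycle exactly when they
   are rotations of each other. *)
Definition unique_directed_hamiltonian_cycle d c : Prop :=
  directed_hamiltonian_cycle d c /\
  forall c', directed_hamiltonian_cycle d c' -> exists k, c' = rot k c.

End Definitions.

(* Main.v *)
Require Import Defs.
From mathcomp Require Import all_boot all_fingroup zify.

(** Label the vertices along a Hamiltonian cycle [v_0, ..., v_(n-1)] and let
    every edge point from its later to its earlier end, except that the edges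
    [v_i v_(i+1)] of the cycle point forward.  The only way up is then one step
    at a time, so a directed Hamiltonian cycle, followed from [v_0], must go
    [v_0, v_1, v_2, ...]: at [v_i] all lower vertices have been visited already.
    Hence the given cycle is the unique directed Hamiltonian cycle
    ([unique_back_orientation]), and an automorphism, which permutes the
    directed Hamiltonian cycles, is a rotation of it by some [k].

    Some of these rotations can be automorphisms if the starting vertex is badly
    chosen.  When the graph is not a cycle it has a chord, and the cycle can be
    cut just after one end of the chord, so that the chord joins [v_(n-1)] to
    some [v_i] with [0 < i]; cutting at the end from which the other one is
    nearer, in the direction of the cycle, gives [2 i < n] ([short_chord]).  A
    rotation by [k] with [0 < k] cannot preserve the arc from [v_(n-1)] to
    [v_i]: if [k <= i] it sends this arc to an upward chord from [v_(k-1)] to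
    [v_(i+k)], and if [i < k] the inverse rotation sends it to an upward chord
    from [v_(n-1-k)] to [v_(n-k+i)] ([rigid_back_orientation]).

    Conversely, in a strongly connected orientation of a cycle no vertex is a
    sink, so all edges point the same way around, and the one-step rotation is a
    nontrivial automorphism ([cycle_graph_not_rigid]). *)

Set Implicit Arguments.
Unset Strict Implicit.
Unset Printing Implicit Defensive.

(** * Orientations of a cycle *)

Section CycleGraph.
Variables (T : finType) (e d : rel T).
Hypotheses (e_irr : irreflexive e) (d_or : orientation e d).

Lemma orientation_asym x y : d x y -> d y x = false.
Proof.
by case: d_or => de dx dxy; have := dx _ _ (de _ _ dxy); rewrite dxy; case: (d y x).
Qed.

Lemma strongly_connected_out x y :
  strongly_connected d -> x != y -> exists z, d x z.
Proof.
move=> sc nxy; case/connectP: (sc x y) => [[|z p]] /=.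
  by move=> _ eyx; rewrite eyx eqxx in nxy.
by case/andP=> dxz _ _; exists z.
Qed.

(** No vertex is a sink, so a single arc from [x] to [next c x] forces all the
    others to follow; otherwise all arcs run against [next c].  Either way
    [next c] preserves the orientation. *)
Lemma cycle_graph_not_rigid :
  strongly_connected d -> cycle_graph e -> ~ rigid d.
Proof.
move=> sc [c [c_gt2 Uc c_all eE]] rig.
have [de dX] := d_or.
have eN x : e x (next c x) by rewrite eE eqxx.
have nN x : x != next c x by apply/eqP=> E; have := eN x; rewrite -E e_irr.
(* An arc entering [next c x] from [x] must leave it on the other side. *)
have step x : d x (next c x) -> d (next c x) (next c (next c x)).
  move=> dx; have [z dyz] := strongly_connected_out sc (nN (next c x)).
  have := de _ _ dyz; rewrite eE => /orP[/eqP<- //|/eqP/(can_inj (prev_next Uc)) Ez].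
  by rewrite -Ez (orientation_asym dx) in dyz.
have nextW x y : exists m, y = iter m (next c) x.
  have := fconnect_cycle (cycle_next Uc) (c_all x) y.
  by rewrite c_all => /iter_findex <-; exists (findex (next c) x y).
have stepW x : d x (next c x) -> forall y, d y (next c y).
  by move=> dx y; have [m ->] := nextW x y; elim: m => //= m /step.
pose s := perm (can_inj (prev_next Uc)).
have s_inj x y : (next c x == next c y) = (x == y).
  exact: (inj_eq (can_inj (prev_next Uc))).
have s_aut : automorphism d s.
  move=> x y; rewrite !permE.
  case: (boolP [exists z, d z (next c z)]) => [/existsP[z /stepW dN] | noN].
    have dE u v : d u v = (v == next c u).
      apply/idP/eqP=> [duv|-> //].
      have := de _ _ duv; rewrite eE => /orP[/eqP //|/eqP Eu].
      by rewrite Eu (orientation_asym (dN v)) in duv.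
    by rewrite !dE s_inj.
  have dN z : d z (next c z) = false.
    by apply/negP=> dz; case/existsP: noN; exists z.
  have dE u v : d u v = (u == next c v).
    apply/idP/eqP=> [duv|->].
      have := de _ _ duv; rewrite eE => /orP[/eqP Ev|/eqP //].
      by rewrite Ev dN in duv.
    by have := dX _ _ (eN v); rewrite dN.
  by rewrite !dE s_inj.
have x0 : T by case: (c) c_gt2.
have := congr1 (fun t : {perm T} => t x0) (rig s s_aut).
by rewrite permE perm1 => /esym/eqP; rewrite (negPf (nN x0)).
Qed.

End CycleGraph.

(** * Directed Hamiltonian cycles *)

Section DirectedHamiltonian.
Variables (T : finType) (d : rel T).

Lemma directed_hamiltonian_rot m c :
  directed_hamiltonian_cycle d c -> directed_hamiltonian_cycle d (rot m c).
Proof.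
by case=> c0 uc c_all; split=> [||x]; rewrite ?size_rot ?rot_ucycle ?mem_rot.
Qed.

Lemma unique_directed_hamiltonian_rot m c :
  unique_directed_hamiltonian_cycle d (rot m c) ->
  unique_directed_hamiltonian_cycle d c.
Proof.
case=> dc uniq_c; split=> [|c' /uniq_c[k ->]].
  by have := directed_hamiltonian_rot (size (rot m c) - m) dc; rewrite -/(rotr m _) rotK.
by exists (rot_add c m k); rewrite rot_rot_add.
Qed.

Lemma directed_hamiltonian_connected c :
  directed_hamiltonian_cycle d c -> strongly_connected d.
Proof. by case=> _ /andP[dc _] c_all x y; apply: (connect_cycle dc). Qed.

Lemma directed_hamiltonian_map (s : {perm T}) c :
  automorphism d s -> directed_hamiltonian_cycle d c ->
  directed_hamiltonian_cycle d (map s c).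
Proof.
move=> s_aut [c0 /andP[dc Uc] c_all]; split; first by rewrite size_map.
  rewrite /ucycle map_inj_uniq ?Uc ?andbT; last exact: perm_inj.
  by rewrite cycle_map; apply: (sub_cycle _ dc) => x y dxy; rewrite /= s_aut.
by move=> x; rewrite -(permKV s x) map_f.
Qed.

End DirectedHamiltonian.

(** * The back orientation along a Hamiltonian cycle *)

Lemma nth_rot (A : Type) (x0 : A) (c : seq A) k j :
  k <= size c -> j < size c ->
  nth x0 (rot k c) j =
    if j + k < size c then nth x0 c (j + k) else nth x0 c (j + k - size c).
Proof.
move=> k_le j_lt; rewrite /rot nth_cat size_drop nth_drop ltn_subRL [k + j]addnC.
by case: ltnP => // nj; rewrite nth_take; [congr nth|]; lia.
Qed.

(** The edge closing the cycle, from the last vertex to the first, needs no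
    clause of its own: it is a downward arc like any chord. *)
Definition back_orientation (T : finType) (e : rel T) (c : seq T) : rel T :=
  fun x y =>
    e x y && ((index y c == (index x c).+1) || ((index y c).+1 < index x c)).

Section BackOrientation.
Variables (T : finType) (e : rel T) (x0 : T) (p : seq T).
Hypotheses (e_sym : symmetric e) (e_irr : irreflexive e).
Local Notation c := (x0 :: p).
Hypothesis c_ham : hamiltonian_cycle e c.
Local Notation d := (back_orientation e c).
Local Notation v := (nth x0 c).

Let n := size c.
Let n_gt2 : 2 < n. Proof. by case: c_ham. Qed.
Let Uc : uniq c. Proof. by case: c_ham => _ /andP[]. Qed.
Let c_all x : x \in c. Proof. by case: c_ham. Qed.

Lemma back_orientationE i j :
  i < n -> j < n -> d (v i) (v j) = e (v i) (v j) && ((j == i.+1) || (j.+1 < i)).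
Proof. by move=> ilt jlt; rewrite /back_orientation !index_uniq. Qed.

Lemma orientation_back : orientation e d.
Proof.
split=> [x y /andP[] //|x y exy].
have nxy : index x c != index y c.
  by apply: contraTneq exy => /index_inj-> //; rewrite e_irr.
rewrite /back_orientation [e y x]e_sym exy.
by apply/addbP; move: nxy; lia.
Qed.

Lemma directed_hamiltonian_back : directed_hamiltonian_cycle d c.
Proof.
split=> //; rewrite /ucycle Uc andbT.
have ec : path.cycle e c by case: c_ham => _ /andP[].
apply/(pathP x0) => i; rewrite size_rcons => i_lt.
have /(pathP x0)/(_ i) := ec; rewrite size_rcons => /(_ i_lt).
rewrite -rcons_cons nth_rcons i_lt nth_rcons.
case: ltnP => i_p.
  rewrite (_ : nth x0 p i = v i.+1) // => ei.
  by rewrite back_orientationE ?ei ?eqxx.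
have Ei : i = size p by apply/eqP; rewrite eqn_leq i_p andbT -ltnS.
rewrite Ei eqxx -[X in e _ X -> _]/(v 0) -[X in _ -> d _ X]/(v 0) => ei.
(* The closing edge goes down by at least two, as [2 < n]. *)
by rewrite back_orientationE // ei; exact: n_gt2.
Qed.

(** From [v i] the only upward arc leads to [v i.+1], and the lower vertices
    have already been visited by a cycle that agrees with [c] up to [v i]. *)
Lemma directed_hamiltonian_back_head q :
  directed_hamiltonian_cycle d (x0 :: q) -> x0 :: q = c.
Proof.
case=> _ /andP[dq Uq] q_all.
have szq : size (x0 :: q) = n.
  apply/perm_size/uniq_perm => // x; by rewrite q_all c_all.
apply: (@eq_from_nth _ x0) => // i; rewrite szq.
elim/ltn_ind: i => [[|i] IH] // i_lt.
have i_lt' := ltnW i_lt.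
have Ei := IH _ (ltnSn i) i_lt'.
have /(pathP x0)/(_ i) := dq; rewrite size_rcons -/(size (x0 :: q)) szq => /(_ i_lt').
rewrite -rcons_cons nth_rcons szq i_lt' nth_rcons.
have i_q : i < size q by rewrite -ltnS -/(size (x0 :: q)) szq.
rewrite i_q (_ : nth x0 q i = nth x0 (x0 :: q) i.+1) // Ei.
set y := nth x0 (x0 :: q) i.+1.
have j_lt : index y c < n by rewrite index_mem.
(* A downward arc would lead to a vertex at which the two cycles agree. *)
rewrite -(nth_index x0 (c_all y)) back_orientationE // => /andP[_].
case/orP=> [/eqP-> //|j_i].
have := IH (index y c); rewrite ltnS => /(_ (ltnW (ltnW j_i)) j_lt).
rewrite nth_index // => /eqP; rewrite nth_uniq ?szq //; lia.
Qed.

Lemma unique_back_orientation : unique_directed_hamiltonian_cycle d c.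
Proof.
split=> [|c' c'_ham]; first exact: directed_hamiltonian_back.
have [_ _ c'_all] := c'_ham; have [i q Eq] := rot_to (c'_all x0).
exists (size c - i); rewrite -/(rotr i c).
have := directed_hamiltonian_rot i c'_ham; rewrite Eq.
by move/directed_hamiltonian_back_head <-; rewrite -Eq rotK.
Qed.

(** A chord from the last vertex to [v i] breaks the rotational symmetry, as
    neither the rotation by [k] (if [k <= i]) nor its inverse (if [i < k])
    maps it to a downward arc.  In the first case [i.*2 < n] ensures that [v i]
    is moved up to [v (i + k)] without wrapping around.  The bounds [0 < i] and
    [i.+2 < n] say that the chord is not an edge of the cycle. *)
Lemma rigid_back_orientation i :
  0 < i -> i.+2 < n -> i.*2 < n -> e (v n.-1) (v i) -> rigid d.
Proof.
move=> i_gt0 i_n i_lt e_i s s_aut.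
have [_ /(_ _ (directed_hamiltonian_map s_aut directed_hamiltonian_back))] :=
  unique_back_orientation.
case=> k'; rewrite rot_minn; set k := minn _ _ => Es.
have k_le : k <= n by rewrite geq_minr.
have sE j : j < n -> s (v j) = if j + k < n then v (j + k) else v (j + k - n).
  by move=> jlt; rewrite -(nth_map x0 x0 s) // Es nth_rot.
have d_i : d (v n.-1) (v i) by rewrite back_orientationE ?e_i; lia.
(* The rotation by [k = n] is the identity too, whence the remainder. *)
case: (posnP (k %% n)) => [k0 | k_gt0].
  apply/permP=> x; rewrite perm1 -(nth_index x0 (c_all x)).
  have x_lt : index x c < n by rewrite index_mem.
  rewrite sE //; case: ltnP => xk; congr nth.
    by rewrite modn_small in k0; lia.
  move: k_le; rewrite leq_eqVlt => /orP[/eqP-> |k_lt]; first by lia.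
  by rewrite modn_small in k0; lia.
have k_lt : k < n.
  by rewrite ltn_neqAle k_le andbT; apply: contraTneq k_gt0 => ->; rewrite modnn.
rewrite modn_small // in k_gt0.
case: (leqP k i) => k_i.
  have := s_aut (v n.-1) (v i); rewrite d_i !sE; [|lia..].
  rewrite ifF ?ifT; [|lia..].
  rewrite back_orientationE; [|lia..].
  by case/andP=> _; lia.
(* The inverse rotation maps the ends of the chord to these two vertices. *)
have := s_aut (v (n.-1 - k)) (v (n - k + i)).
rewrite !sE; [|lia..].
rewrite ifT ?ifF; [|lia..].
rewrite (_ : n.-1 - k + k = n.-1) 1?(_ : n - k + i + k - n = i); [|lia..].
rewrite d_i back_orientationE; [|lia..].
by move/esym/andP=> [_]; lia.
Qed.

End BackOrientation.

(** * Cutting the cycle at a chord *)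

Section ShortChord.
Variables (T : finType) (e : rel T) (c : seq T).
Hypotheses (e_sym : symmetric e) (e_irr : irreflexive e).
Hypothesis c_ham : hamiltonian_cycle e c.

Lemma chord_exists :
  ~ cycle_graph e -> exists x y, [/\ e x y, y != next c x & x != next c y].
Proof.
move=> ncyc.
case: (boolP [exists x, exists y, [&& e x y, y != next c x & x != next c y]]).
  by case/existsP=> x /existsP[y /and3P[]]; exists x, y.
move=> no; case: ncyc; have [c_gt2 /andP[ec Uc] c_all] := c_ham.
exists c; split=> // x y; apply/idP/idP=> [exy|].
  apply: contraR no; rewrite negb_or => /andP[nx ny].
  by apply/existsP; exists x; apply/existsP; exists y; rewrite exy nx ny.
by case/orP=> /eqP->; [|rewrite e_sym]; apply: next_cycle.
Qed.

(** The ends of a chord split the rest of the cycle into two arcs [p1] and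
    [p2]; the cut after one end of the chord makes the other end come after
    [p1], the cut after the other makes it come after [p2], and one of these
    has less than half of the vertices. *)
Lemma short_chord :
  ~ cycle_graph e ->
  exists m x0 p i, [/\ rot m c = x0 :: p, 0 < i < (size c).-2, i.*2 < size c &
    e (last x0 p) (nth x0 (x0 :: p) i)].
Proof.
move=> ncyc; have [c_gt2 /andP[ec Uc] c_all] := c_ham.
have [x [y [exy nx ny]]] := chord_exists ncyc.
have nxy : x != y by apply: contraTneq exy => ->; rewrite e_irr.
have [m [p1 [p2 Em]]] : exists m (p1 p2 : seq T), rot m c = x :: p1 ++ y :: p2.
  by have [m p1 p2] := rot_to_arc Uc (c_all x) (c_all y) nxy; exists m, p1, p2.
have sz : size c = (size p1 + size p2).+2.
  by rewrite -(size_rot m) Em /= size_cat /= addnS.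
(* The arcs are nonempty because the ends of a chord are not consecutive. *)
have p1_gt0 : 0 < size p1.
  case: p1 Em {sz} => // Em; move: nx.
  by rewrite -(next_rot m Uc) Em /= eqxx eqxx.
have p2_gt0 : 0 < size p2.
  case: p2 Em {sz} => // Em; move: ny.
  have Er : rot (size p1).+1 (rot m c) = [:: y, x & p1].
    by rewrite Em; exact: rot_size_cat (x :: p1) _.
  by rewrite -(next_rot m Uc) -(next_rot (size p1).+1) ?rot_uniq // Er /= !eqxx.
have cut a b q1 q2 k : rot k c = a :: q1 ++ b :: q2 -> e a b ->
    0 < size q1 < (size c).-2 -> (size q1).*2 < size c ->
  exists m x0 p i, [/\ rot m c = x0 :: p, 0 < i < (size c).-2, i.*2 < size c &
    e (last x0 p) (nth x0 (x0 :: p) i)].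
  case: q1 => // x0 q1 Ek eab q1_n q1_lt.
  (* Rotating by one more step moves [a] to the end of the list. *)
  exists (rot_add c k 1), x0, (q1 ++ b :: rcons q2 a), (size q1).+1; split=> //.
    by rewrite -rot_rot_add Ek rot1_cons /= rcons_cat.
  by rewrite last_cat /= last_rcons nth_cat ltnn subnn.
case: (leqP (size p1) (size p2)) => p12.
  by apply: (cut x y p1 p2 m) => //; lia.
apply: (cut y x p2 p1 (rot_add c m (size p1).+1)); [|by rewrite e_sym|lia|lia].
by rewrite -rot_rot_add Em -cat_cons -[(size p1).+1]/(size (x :: p1)) rot_size_cat.
Qed.

End ShortChord.

Lemma rigid_orientation_of_cycle (T : finType) (e : rel T) (c : seq T)
    (e_sym : symmetric e) (e_irr : irreflexive e) :
  ~ cycle_graph e -> hamiltonian_cycle e c ->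
  exists d : rel T,
    [/\ orientation e d, strongly_connected d, rigid d &
        unique_directed_hamiltonian_cycle d c].
Proof.
move=> ncyc c_ham.
have [m [x0 [p [i [Em /andP[i_gt0 i_n] i_lt e_i]]]]] := short_chord e_sym e_irr c_ham ncyc.
have rot_ham : hamiltonian_cycle e (x0 :: p).
  case: c_ham => c_gt2 ec c_all; rewrite -Em.
  by split=> [||x]; rewrite ?size_rot ?rot_ucycle ?mem_rot.
have uni := unique_back_orientation rot_ham.
exists (back_orientation e (x0 :: p)); split.
- exact: orientation_back rot_ham.
- exact: directed_hamiltonian_connected uni.1.
- have sz : size (x0 :: p) = size c by rewrite -Em size_rot.
  apply: (rigid_back_orientation rot_ham i_gt0); rewrite ?nth_last ?sz //; lia.
- by apply: (@unique_directed_hamiltonian_rot _ _ m); rewrite Em.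
Qed.

Theorem lemma14 (T : finType) (e : rel T)
    (e_sym : symmetric e) (e_irr : irreflexive e)
    (e_ham : hamiltonian e) :
  ((exists d : rel T,
      [/\ orientation e d, strongly_connected d & rigid d])
   <-> ~ cycle_graph e)
  /\
  (~ cycle_graph e ->
   forall c : seq T, hamiltonian_cycle e c ->
   exists d : rel T,
     [/\ orientation e d, strongly_connected d, rigid d &
         unique_directed_hamiltonian_cycle d c \/
         unique_directed_hamiltonian_cycle d (rev c)]).
Proof.
split; last first.
  move=> ncyc c c_ham.
  have [d [d_or sc rig uni]] := rigid_orientation_of_cycle e_sym e_irr ncyc c_ham.
  by exists d; split=> //; left.
split=> [[d [d_or sc rig]] cyc | ncyc].
  exact: (cycle_graph_not_rigid e_irr d_or sc cyc rig).
have [c c_ham] := e_ham.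
have [d [d_or sc rig _]] := rigid_orientation_of_cycle e_sym e_irr ncyc c_ham.
by exists d.
Qed.
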